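(* Let $G$ be a second countable Hausdorff minimal étale groupoid with a compact metrizable unit space of finite Lebesgue covering dimension. Then $G$ has the thin boundary property.
   Context: Étale groupoids are locally compact topological groupoids whose range and source maps $r,s\colon G\to G^{(0)}$ are local homeomorphisms. A subset $Y\subset G^{(0)}$ is invariant if $Y=r(s^{-1}(Y))$; $G$ is minimal if $\emptyset$ and $G^{(0)}$ are the only closed invariant subsets of $G^{(0)}$. An open bisection is an open set $B\subset G$ such that $r|_B\colon B\to r(B)$ and $s|_B\colon B\to s(B)$ are homeomorphisms onto their images. For $A\subset G^{(0)}$ closed and $U\subset G^{(0)}$ open, write $A\prec U$ if there are open bisections $B_1,\dots,B_n\subset G$ such that $A\subset s(B_1)\cup\dots\cup s(B_n)$ and $r(B_1),\dots,r(B_n)$ are pairwise disjoint subsets of $U$. A closed subset $A\subset G^{(0)}$ is $G$-thin if $A\prec U$ for every nonempty open subset $U\subset G^{(0)}$. $G$ has the thin boundary property if there is a basis $\mathcal B$ for the topology of $G^{(0)}$ such that for each $U\in\mathcal B$ the boundary $\partial U$ is $G$-thin. *)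

(* Defs.v *)
From HB Require Import structures.
From mathcomp Require Import all_boot all_order all_algebra.
From mathcomp Require Import all_classical all_reals all_analysis.

Set Implicit Arguments.
Unset Strict Implicit.
Unset Printing Implicit Defensive.

Local Open Scope classical_set_scope.
Local Open Scope card_scope.

(* The restriction of [f] to [A] is a homeomorphism from [A] onto [f @` A],
   both with the subspace topology.  The values of [g] outside [f @` A] are
   irrelevant. *)
Definition homeo_onto_image (T U : topologicalType) (f : T -> U) (A : set T) :=
  exists g : U -> T,
    [/\ {in A, cancel f g}, {within A, continuous f} &
        {within f @` A, continuous g}].

Definition local_homeo (T U : topologicalType) (f : T -> U) :=
  forall x : T, exists V : set T,
    [/\ open V, V x, open (f @` V) & homeo_onto_image f V].

Definition homeomorphic (T U : topologicalType) :=
  exists (f : T -> U) (g : U -> T),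
    [/\ cancel f g, cancel g f, continuous f & continuous g].

Definition metrizable (R : realType) (T : topologicalType) :=
  exists M : metricType R, homeomorphic T M.

Definition boundary (T : topologicalType) (A : set T) : set T :=
  closure A `\` A°.

Definition open_cover (T : topologicalType) (C : set (set T)) :=
  C `<=` open /\ \bigcup_(V in C) V = [set: T].

Definition refines (T : Type) (C D : set (set T)) :=
  forall V, C V -> exists2 W, D W & V `<=` W.

Definition covering_dim_le (T : topologicalType) (n : nat) :=
  forall C : set (set T), open_cover C ->
    exists D : set (set T),
      [/\ open_cover D, refines D C &
          forall x : T, [set V | D V /\ V x] #<= `I_n.+1].

Definition finite_covering_dim (T : topologicalType) :=
  exists n : nat, covering_dim_le T n.

(* Topological groupoid with unit space [X] and space of arrows [G].  The unit
   space is a separate type, identified with a subspace of [G] by [gunit]: since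
   [gsrc \o gunit] is the identity and both maps are continuous, [gunit] is a
   homeomorphism onto its image.  An arrow [g] goes from [gsrc g] to [grng g].
   The product [gmul g h] is meaningful only when [gsrc g = grng h]: neither the
   algebraic axioms nor continuity say anything about other pairs. *)
Record topGroupoid (X G : topologicalType) := TopGroupoid {
  grng : G -> X;
  gsrc : G -> X;
  gunit : X -> G;
  ginv : G -> G;
  gmul : G -> G -> G;
  grng_unit : forall x, grng (gunit x) = x;
  gsrc_unit : forall x, gsrc (gunit x) = x;
  grng_mul : forall g h, gsrc g = grng h -> grng (gmul g h) = grng g;
  gsrc_mul : forall g h, gsrc g = grng h -> gsrc (gmul g h) = gsrc h;
  gmulA : forall g h k, gsrc g = grng h -> gsrc h = grng k ->
    gmul g (gmul h k) = gmul (gmul g h) k;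
  gmul1g : forall g, gmul (gunit (grng g)) g = g;
  gmulg1 : forall g, gmul g (gunit (gsrc g)) = g;
  grng_inv : forall g, grng (ginv g) = gsrc g;
  gsrc_inv : forall g, gsrc (ginv g) = grng g;
  gmulVg : forall g, gmul (ginv g) g = gunit (gsrc g);
  gmulgV : forall g, gmul g (ginv g) = gunit (grng g);
  grng_continuous : continuous grng;
  gsrc_continuous : continuous gsrc;
  gunit_continuous : continuous gunit;
  ginv_continuous : continuous ginv;
  gmul_continuous :
    {within [set p : G * G | gsrc p.1 = grng p.2],
      continuous (fun p : G * G => gmul p.1 p.2)}
}.

Section Groupoid.
Variables (X G : topologicalType) (Gam : topGroupoid X G).

Definition etale :=
  [/\ locally_compact [set: G], local_homeo (grng Gam) &
      local_homeo (gsrc Gam)].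

Definition groupoid_invariant (Y : set X) := Y = grng Gam @` (gsrc Gam @^-1` Y).

Definition minimal :=
  forall Y : set X, closed Y -> groupoid_invariant Y -> Y = set0 \/ Y = [set: X].

Definition open_bisection (B : set G) :=
  [/\ open B, homeo_onto_image (grng Gam) B & homeo_onto_image (gsrc Gam) B].

(* The relation "A \prec U". *)
Definition subequiv (A U : set X) :=
  exists (n : nat) (B : 'I_n -> set G),
    [/\ forall i, open_bisection (B i),
        A `<=` \bigcup_i (gsrc Gam @` B i),
        trivIset [set: 'I_n] (fun i => grng Gam @` B i) &
        forall i, grng Gam @` B i `<=` U].

Definition thin (A : set X) :=
  closed A /\ forall U : set X, open U -> U !=set0 -> subequiv A U.

Definition thin_boundary_property :=
  exists2 B : set (set X), basis B & forall U, B U -> thin (boundary U).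

End Groupoid.

(* Main.v *)
Require Import Defs.
From mathcomp Require Import all_boot all_order all_algebra.
From mathcomp Require Import all_classical all_reals all_analysis.

Set Implicit Arguments.
Unset Strict Implicit.
Unset Printing Implicit Defensive.

Local Open Scope classical_set_scope.

(** The proof goes through closed sets [E] that meet every orbit in at most
[k] points, for a uniform [k].  Two facts are combined, [n] being a bound for
the covering dimension of the unit space [X].

Such sets are thin when [X] has no isolated points
([orbit_meets_le_thin]).  By minimality every point of [X] can be moved into
any prescribed nonempty open set by an open bisection, so the only obstruction
to comparison is that the translates of different pieces of [E] may collide.
Finite dimension removes the collisions between neighbouring pieces: a
cover of [X] can be refined to [n.+1] colour classes of closed sets, each
class being a disjoint family ([coloured_closed_refinement]), and the classes
are sent to disjoint open sets.  Within a class, number the pieces and let [R]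
be the set of points whose translate hits the translate of a piece with a
smaller number.  In every orbit, a point of [R] lying in the piece with the
smallest possible number collides with a point of [E] outside [R]; hence [R]
meets orbits in at most [k.-1] points, and it is thin by induction.  The
part of [E] outside a neighbourhood of [R] has disjoint compact translates
([disjoint_pieces_subequiv]).

There is a basis of open sets whose boundaries meet every orbit in at most [n]
points ([neighbourhood_small_boundary]).  The boundary is pinned down by a
growing sequence of pairs of disjoint closed sets [(P, Q)], the points of
[U] and of its exterior decided so far.  For [n.+1] compact bisections with
disjoint ranges, a coloured refinement allows the pair to be enlarged so that,
among the [n.+1] images of any unit, at least one gets decided: the piece of
colour [i] containing the unit is transported by the [i]-th bisection and
added, as a whole, to one side ([separation_step]).  Second countability
leaves countably many such families of bisections, and they cover all
families of [n.+1] distinct points of an orbit.  Only distinct points of the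
same orbit are ever compared, so isotropy is harmless.

If [X] has an isolated point, minimality makes it discrete and all boundaries
are empty ([isolated_point_discrete]). *)

(** * Compact Hausdorff spaces *)

Lemma open_subset_interior_closure (T : topologicalType) (U : set T) :
  open U -> U `<=` (closure U)°.
Proof.
move=> oU; rewrite -[X in X `<=` _](interior_id _).1 //.
by apply: interiorS; exact: subset_closure.
Qed.

Lemma compact_image_closed (T U : topologicalType) (f : T -> U) (A : set T) :
  hausdorff_space U -> continuous f -> compact A -> closed (f @` A).
Proof.
move=> T2 cf cA; apply: compact_closed => //.
by apply: continuous_compact => //; exact: continuous_subspaceT.
Qed.

Section FiniteFamilies.
Context {T : topologicalType} {I : finType}.

Lemma open_bigcap_fin (F : I -> set T) (D : set I) :
  (forall i, D i -> open (F i)) -> open (\bigcap_(i in D) F i).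
Proof.
move=> oF; rewrite -[X in open X]setCK openC setC_bigcap.
apply: closed_bigcup; first exact: finite_finset.
by move=> i /oF/open_closedC.
Qed.

Lemma closed_bigcup_fin (F : I -> set T) (D : set I) :
  (forall i, D i -> closed (F i)) -> closed (\bigcup_(i in D) F i).
Proof. by move=> cF; apply: closed_bigcup => //; exact: finite_finset. Qed.

End FiniteFamilies.

Section CompactHausdorff.
Context {T : topologicalType}.

(** The covering criterion for compactness of a space that may be empty: the
filter is the one of finite lists that are large enough. *)
Lemma compact_finite_subcover (J : choiceType) (f : J -> set T) :
  compact [set: T] -> (forall j, open (f j)) -> (forall x, exists j, f j x) ->
  exists s : seq J, forall x, exists2 j, j \in s & f j x.
Proof.
move=> /compact_near_coveringP cT fo fc.
pose F : set_system (seq J) :=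
  [set A | exists s0 : seq J, forall s, {subset s0 <= s} -> A s].
have FF : Filter F.
  split; first by exists [::].
    move=> A B [s As] [t Bt]; exists (s ++ t) => u su; split.
      by apply: As => j js; apply: su; rewrite mem_cat js.
    by apply: Bt => j js; apply: su; rewrite mem_cat js orbT.
  by move=> A B AB [s As]; exists s => u /As /AB.
have [|s cs] := cT _ F (fun s x => exists2 j, j \in s & f j x) FF.
  move=> x _; have [j fjx] := fc x.
  exists (f j, [set s | {subset [:: j] <= s}]) => /=.
    split; first exact: open_nbhs_nbhs.
    by exists [:: j].
  by move=> [y s] /= [fy js]; exists j => //; apply: js; rewrite inE.
by exists s => x; exact: cs s (fun _ h => h) x I.
Qed.

Hypothesis T2 : hausdorff_space T.

Lemma hausdorff_closed_set1 (x : T) : closed [set x].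
Proof. exact: accessible_closed_set1 (hausdorff_accessible T2) x. Qed.

Hypothesis cT : compact [set: T].

Lemma compact_hausdorff_insert (A U : set T) : closed A -> open U -> A `<=` U ->
  exists V, [/\ open V, A `<=` V & closure V `<=` U].
Proof.
move=> cA oU AU.
have [|W /set_nbhsP[V [oV AV VW]] WU] := compact_normal T2 cT cA (t := U).
  by apply/set_nbhsP; exists U; split=> // x.
by exists V; split=> //; apply: subset_trans WU; exact: closureS.
Qed.

Lemma compact_hausdorff_separate (A B : set T) :
  closed A -> closed B -> A `&` B = set0 ->
  exists U V, [/\ open U, open V, A `<=` U, B `<=` V
    & closure U `&` closure V = set0].
Proof.
move=> cA cB AB.
have [||V [oV AV VB]] := @compact_hausdorff_insert A (~` B) cA.
- exact: closed_openC.
- by apply/disjoints_subset.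
have [||W [oW BW WV]] := @compact_hausdorff_insert B (~` closure V) cB.
- exact/closed_openC/closed_closure.
- by move=> x Bx Vx; exact: VB Vx Bx.
exists V, W; split=> //=; apply/disjoints_subset.
by apply: subsetCr.
Qed.

(** Each member is separated from the union of the others. *)
Lemma compact_hausdorff_separate_fin (I : finType) (K : I -> set T) :
  (forall i, closed (K i)) -> trivIset setT K ->
  exists O : I -> set T, [/\ forall i, open (O i), forall i, K i `<=` O i
    & trivIset setT O].
Proof.
move=> cK dK.
have sep i : exists UV : set T * set T, [/\ open UV.1, open UV.2,
    K i `<=` UV.1, forall j, j != i -> K j `<=` UV.2 & UV.1 `&` UV.2 = set0].
  have [|||U [V [oU oV KU KV UV]]] :=
      @compact_hausdorff_separate (K i) (\bigcup_(j in [set j | j != i]) K j).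
  - exact: cK.
  - by apply: closed_bigcup_fin => j _; exact: cK.
  - rewrite -subset0 => x [Kix [j /= ji Kjx]].
    by case/eqP: ji; apply/esym/dK => //; exists x.
  exists (U, V); split=> //=.
    by move=> j ji; apply: subset_trans KV; exact: bigcup_sup.
  rewrite -subset0 => x [Ux Vx]; rewrite -UV.
  by split; exact: subset_closure.
have [UV UVP] := choice sep.
(* The open set around [K i] must also avoid the sets chosen around the other
   members, hence the intersection over [j]. *)
exists (fun i => (UV i).1 `&` \bigcap_(j in [set j | j != i]) (UV j).2).
split=> [i|i x Kx|].
- apply: openI; first by have [] := UVP i.
  by apply: open_bigcap_fin => j _; have [] := UVP j.
- split; first by have [_ _ + _ _] := UVP i; exact.
  move=> j /= ji; have [_ _ _ + _] := UVP j; apply; last exact: Kx.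
  by rewrite eq_sym.
apply/trivIsetP => i j _ _ ij; rewrite -subset0 => x [[Ui _] [_ Uj]].
by have [_ _ _ _ <-] := UVP i; split=> //; exact: Uj.
Qed.

Lemma shrink_open_cover (I : finType) (V : I -> set T) :
  (forall i, open (V i)) -> (forall x, exists i, V i x) ->
  exists H : I -> set T, [/\ forall i, closed (H i), forall i, H i `<=` V i
    & forall x, exists i, H i x].
Proof.
move=> oV cV.
have loc x : exists Wi : set T * I,
    [/\ open Wi.1, Wi.1 x & closure Wi.1 `<=` V Wi.2].
  have [i Vix] := cV x.
  have [||W [oW xW WV]] := @compact_hausdorff_insert [set x] (V i) _ (oV i).
  - exact: hausdorff_closed_set1.
  - by move=> _ ->.
  by exists (W, i); split=> //; exact: xW.
have [Wi WiP] := choice loc.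
have [||s sP] := @compact_finite_subcover T (fun x => (Wi x).1) cT.
- by move=> x; have [] := WiP x.
- by move=> x; exists x; have [] := WiP x.
exists (fun i => \bigcup_(x in [set x | x \in s /\ (Wi x).2 = i])
  closure (Wi x).1); split.
- move=> i; apply: closed_bigcup => [|x _]; last exact: closed_closure.
  by apply: (@sub_finite_set _ _ [set` s]) => [x []|]; last exact: finite_seq.
- by move=> i x [y [_ <-]]; have [_ _ +] := WiP y; exact.
- move=> x; have [y ys Wx] := sP x; exists (Wi y).2, y; first by split.
  exact: subset_closure.
Qed.

(** * Coloured refinements *)

Lemma covering_dim_le_finite (n : nat) (C : set (set T)) :
  covering_dim_le T n -> open_cover C ->
  exists (I : finType) (V : I -> set T),
    [/\ forall i, open (V i), forall x, exists i, V i x,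
        forall i, exists2 W, C W & V i `<=` W &
        forall x, (#|[set i | `[< V i x >]]%SET| <= n.+1)%N].
Proof.
move=> dim /dim[D [[oD cD] DC ordD]].
have [||s sP] := @compact_finite_subcover _ (fun V => [set x | D V /\ V x]) cT.
- move=> V; have [DV|nDV] := pselect (D V).
    rewrite (_ : [set x | _] = V); first exact: oD.
    by apply/seteqP; split=> x //= [].
  rewrite (_ : [set x | _] = set0); first exact: open0.
  by apply/seteqP; split=> x //= [].
- by move=> x; have : setT x by []; rewrite -cD => -[V DV Vx]; exists V.
pose t := [seq V <- s | `[< D V >]].
have tD (i : seq_sub t) : D (ssval i).
  by have := ssvalP i; rewrite mem_filter => /andP[/asboolP].
exists (seq_sub t), (@ssval _ t); split.
- by move=> i; exact/oD/tD.
- move=> x; have [V Vs [DV Vx]] := sP x.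
  have Vt : V \in t by rewrite mem_filter Vs andbT; exact/asboolP.
  by exists (SeqSub Vt).
- by move=> i; exact/DC/tD.
move=> x; have /pcard_leP/injfunPex[h hI hinj] := ordD x.
pose f (i : seq_sub t) : 'I_n.+1 := inord (h (ssval i)).
have memx (i : seq_sub t) : i \in [set i | `[< ssval i x >]]%SET ->
    [set V | D V /\ V x] (ssval i).
  by rewrite finset.inE => /asboolP; split.
rewrite -[X in (_ <= X)%N]card_ord -(@card_in_imset _ _ f) ?max_card//.
move=> i j /memx xi /memx xj /(congr1 val).
rewrite /= !inordK; [|exact: hI xj|exact: hI xi].
by move=> /hinj => /(_ (mem_set xi) (mem_set xj)) /val_inj.
Qed.


(** Take a finite cover [V] of order at most [n.+1] and, inside each [V i],
closed sets [L 0 i], [L 1 i], ..., each in the interior of the next, with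
[L 0] still covering.  A set [S] of indices with [c.+1] elements carries the
piece of colour [c] made of the points that are in [L c i] for [i] in [S] and
outside the interior of [L c.+1 i] for the other [i]; two such pieces are
disjoint because of the gap between [L c] and [L c.+1].  The pieces cover:
the sets [N k] of the indices [i] with [x] in [L k i] increase with [k] and
have at most [n.+1] elements, so they cannot satisfy [k < #|N k|] up to
[k = n.+1], and where this first fails, [N] is stationary. *)
Lemma coloured_closed_refinement (n : nat) (C : set (set T)) :
  covering_dim_le T n -> open_cover C ->
  exists (J : finType) (F : 'I_n.+1 -> J -> set T),
    [/\ forall c j, closed (F c j), forall c, trivIset setT (F c),
        forall c j, F c j !=set0 -> exists2 W, C W & F c j `<=` W &
        forall x, exists c j, F c j x].
Proof.
move=> dim oC.
have [J [V [oV cV VC ordV]]] := covering_dim_le_finite dim oC.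
have [H [cH HV covH]] := shrink_open_cover oV cV.
have /choice[e eP] (AU : set T * set T) : exists B,
    closed AU.1 -> open AU.2 -> AU.1 `<=` AU.2 ->
    [/\ open B, AU.1 `<=` B & closure B `<=` AU.2].
  have [[cA oU AU2]|h] := pselect [/\ closed AU.1, open AU.2 & AU.1 `<=` AU.2].
    by have [B BP] := compact_hausdorff_insert cA oU AU2; exists B.
  by exists set0 => cA oU AU2; case: h.
pose L := fix L (k : nat) i : set T :=
  if k is k'.+1 then closure (e (L k' i, V i)) else H i.
have LP k i : closed (L k i) /\ L k i `<=` V i.
  elim: k => [|k [cL LV]] /=; first by split; [exact: cH|exact: HV].
  by split; [exact: closed_closure|have [] := eP (L k i, V i) cL (oV i) LV].
have LS k i : L k i `<=` (L k.+1 i)°.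
  have [cL LV] := LP k i; have [oe Le _] := eP (L k i, V i) cL (oV i) LV.
  by move=> x /Le; exact: open_subset_interior_closure.
pose F (c : 'I_n.+1) (S : {set J}) := [set x | [/\ #|S| = c.+1,
  forall i, i \in S -> L c i x & forall i, i \notin S -> ~ (L c.+1 i)° x]].
exists {set J}, F; split.
- move=> c S; have [cardS|cardS] := eqVneq #|S| c.+1; last first.
    rewrite (_ : F c S = set0); first exact: closed0.
    by apply/seteqP; split => // x [/eqP]; rewrite (negbTE cardS).
  rewrite (_ : F c S = \bigcap_(i in [set i | i \in S]) L c i `&`
      \bigcap_(i in [set i | i \notin S]) ~` (L c.+1 i)°).
    apply: closedI; apply: closed_bigI => i _; first by have [] := LP c i.
    exact/open_closedC/open_interior.
  by apply/seteqP; split => [x []//|x []]; split.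
- move=> c; apply/trivIsetP => S S' _ _; apply: contra_neqP => /eqP/set0P[x].
  move=> [[_ LS1 LS2] [_ LS1' LS2']].
  apply/setP => i; apply/idP/idP => iS; apply/negPn/negP => niS.
    by apply: (LS2' i niS); exact/LS/LS1.
  by apply: (LS2 i niS); exact/LS/LS1'.
- move=> c S [x [cardS _ _]].
  have /card_gt0P[i iS] : (0 < #|S|)%N by rewrite cardS.
  have [W CW VW] := VC i; exists W => // y [_ + _].
  by move=> /(_ i iS) Ly; apply: VW; have [_] := LP c i; exact.
move=> x; pose N k : {set J} := [set i | `[< L k i x >]]%SET.
have NS k : N k \subset N k.+1.
  apply/fintype.subsetP => i; rewrite !finset.inE => /asboolP Lx; apply/asboolP.
  by apply: interior_subset; exact: LS.
apply: contrapT => nF.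
(* Without a piece containing [x], the sets [N k] would keep growing. *)
have big k : (k <= n.+1)%N -> (k < #|N k|)%N.
  elim: k => [_|k IH kn].
    have [i Hix] := covH x; apply/card_gt0P; exists i.
    by rewrite finset.inE; exact/asboolP.
  have kN := IH (ltnW kn); rewrite ltnNge; apply/negP => Nk.
  have NE : N k = N k.+1.
    by apply/eqP; rewrite eqEcard NS /= (leq_trans Nk).
  apply: nF; exists (Ordinal kn), (N k); split => /=.
  - by apply/eqP; rewrite eqn_leq kN andbT NE.
  - by move=> i; rewrite finset.inE => /asboolP.
  - move=> i; rewrite NE finset.inE => /asboolP nL /interior_subset; exact: nL.
have := big n.+1 (leqnn _); rewrite ltnNge => /negP; apply.
apply: leq_trans (ordV x); apply: subset_leq_card.
apply/fintype.subsetP => i; rewrite !finset.inE => /asboolP Lx; apply/asboolP.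
by have [_] := LP n.+1 i; exact.
Qed.

End CompactHausdorff.

(** * Separation along finitely many bisections *)

Section Separation.
Context {X G : topologicalType} (r s : G -> X) (n : nat).
Hypotheses (T2X : hausdorff_space X) (cX : compact [set: X]).
Hypothesis dimX : covering_dim_le X n.
Hypotheses (cr : continuous r) (cs : continuous s).

Let closed_transport (f g : G -> X) (K : set G) (A : set X) :
  continuous f -> continuous g -> compact K -> closed A ->
  closed (f @` (K `&` g @^-1` A)).
Proof.
move=> cf cg cK cA; apply: compact_image_closed => //.
by apply: compact_closedI => //; have /continuous_closedP := cg; exact.
Qed.

(** Think of [K i] as the partial homeomorphism sending [s g] to [r g], for [g]
in [K i].  The sets of the cover are chosen so small that their image under
each [K i] misses [P] or misses [Q].  In a coloured refinement, the pieces of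
colour [i] can be transported by [K i] and added to a side that stays
disjoint from the other one: images under different [K i] are disjoint, and so
are images of different pieces of the same colour.  Since every unit lies
in a piece of some colour [i], its image under that [K i] is then in the
enlarged [P] or [Q]. *)
Lemma separation_step (K : 'I_n.+1 -> set G) (P Q : set X) :
  (forall i, compact (K i)) ->
  (forall i, set_inj (K i) r) -> (forall i, set_inj (K i) s) ->
  trivIset setT (fun i => r @` K i) ->
  closed P -> closed Q -> P `&` Q = set0 ->
  exists P' Q' : set X, [/\ closed P', closed Q', P' `&` Q' = set0,
    P `<=` P'° /\ Q `<=` Q'° &
    forall z g, (forall i, K i (g i)) -> (forall i, s (g i) = z) ->
      exists i, (P'° `|` Q'°) (r (g i))].
Proof.
move=> cK rK sK dK cP cQ PQ.
pose pull i A := s @` (K i `&` r @^-1` A).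
pose V (c : {ffun 'I_n.+1 -> bool}) :=
  ~` \bigcup_(i in setT) pull i (if c i then P else Q).
have oV c : open (V c).
  apply: closed_openC; apply: closed_bigcup_fin => i _.
  by case: ifP => _; exact: closed_transport.
have covV : open_cover (range V).
  split; first by move=> _ [c _ <-]; exact: oV.
  apply/seteqP; split=> // x _.
  pose c := [ffun i => `[< ~ pull i P x >]].
  exists (V c); first by exists c.
  move=> [i _]; rewrite ffunE; case: asboolP => [//|/contrapT[g [Kg Pg] gx]].
  move=> [h [Kh Qh] hx]; have hg : h = g.
    by apply: (sK i); rewrite ?inE// gx.
  suff : (P `&` Q) (r g) by rewrite PQ.
  by split => //; rewrite -hg.
have [J [F [cF dF FV covF]]] := coloured_closed_refinement T2X cX dimX covV.
(* Only the colour [c] matters for a piece of that colour, although the cover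
   takes all the [K i] into account. *)
have side c j : F c j `&` pull c P = set0 \/ F c j `&` pull c Q = set0.
  have [F0|/set0P/FV[_ [t _ <-]] FVt] := eqVneq (F c j) set0.
    by left; rewrite F0 set0I.
  have avoid : F c j `&` pull c (if t c then P else Q) = set0.
    by rewrite -subset0 => x [/FVt + px]; apply; exists c.
  by case: (t c) avoid => ?; [left|right].
pose piece c j := r @` (K c `&` s @^-1` F c j).
pose P1 := P `|` \bigcup_(p in [set p | F p.1 p.2 `&` pull p.1 Q = set0])
  piece p.1 p.2.
pose Q1 := Q `|` \bigcup_(p in [set p | F p.1 p.2 `&` pull p.1 Q <> set0])
  piece p.1 p.2.
have cpiece c j : closed (piece c j) by exact: closed_transport.
have cP1 : closed P1.
  by apply: closedU => //; apply: closed_bigcup_fin => p _; exact: cpiece.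
have cQ1 : closed Q1.
  by apply: closedU => //; apply: closed_bigcup_fin => p _; exact: cpiece.
have PQ1 : P1 `&` Q1 = set0.
  rewrite -subset0 => x [[Px|[[c j] /= FQ [g [Kg Fg] gx]]]].
    move=> [Qx|[[c j] /= FQ [g [Kg Fg] gx]]].
      by rewrite -PQ.
    have [FP|//] := side c j.
    suff : set0 (s g) by [].
    rewrite -FP; split => //.
    by exists g => //; split => //=; rewrite gx.
  move=> [Qx|[[d k] /= FQ' [h [Kh Fh] hx]]].
    suff : set0 (s g) by [].
    rewrite -FQ; split => //.
    by exists g => //; split => //=; rewrite gx.
  have cd : c = d by apply: dK => //; exists x; split; [exists g|exists h].
  subst d; have gh : g = h by apply: (rK c); rewrite ?inE// gx.
  subst h; have jk : j = k by apply: (dF c) => //; exists (s g).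
  by subst k.
have [U [W [oU oW PU QW UW]]] :=
  compact_hausdorff_separate T2X cX cP1 cQ1 PQ1.
have Ucl := open_subset_interior_closure oU.
have Wcl := open_subset_interior_closure oW.
exists (closure U), (closure W); split => //.
- exact: closed_closure.
- exact: closed_closure.
- by split=> x Ax; [apply/Ucl/PU; left|apply/Wcl/QW; left].
move=> z g Kg sg; have [c [j Fz]] := covF z; exists c.
have px : piece c j (r (g c)) by exists (g c) => //; split => //=; rewrite sg.
have [FQ|FQ] := pselect (F c j `&` pull c Q = set0).
  by left; apply/Ucl/PU; right; exists (c, j).
by right; apply/Wcl/QW; right; exists (c, j).
Qed.

(** Iterating the previous construction gives disjoint open sets whose
complement contains no full family of images of a unit, for any of the
countably many families.  Each closed set of the sequence is in the interior of
the next, which makes the unions open. *)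
Lemma separation_countable (K : nat -> 'I_n.+1 -> set G) (P Q : set X) :
  (forall k i, compact (K k i)) ->
  (forall k i, set_inj (K k i) r) -> (forall k i, set_inj (K k i) s) ->
  (forall k, trivIset setT (fun i => r @` K k i)) ->
  closed P -> closed Q -> P `&` Q = set0 ->
  exists U W : set X, [/\ open U, open W, P `<=` U, Q `<=` W & U `&` W = set0 /\
    forall k z g, (forall i, K k i (g i)) -> (forall i, s (g i) = z) ->
      exists i, (U `|` W) (r (g i))].
Proof.
move=> cK rK sK dK cP cQ PQ.
pose good (A : set X * set X) := [/\ closed A.1, closed A.2 & A.1 `&` A.2 = set0].
have /choice[step stepP] (kA : nat * (set X * set X)) : exists B, good kA.2 ->
    [/\ good B, kA.2.1 `<=` B.1°, kA.2.2 `<=` B.2° &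
    forall z g, (forall i, K kA.1 i (g i)) -> (forall i, s (g i) = z) ->
      exists i, (B.1° `|` B.2°) (r (g i))].
  have [[c1 c2 d]|] := pselect (good kA.2); last by exists kA.2.
  have [P' [Q' [? ? ? [? ?] ?]]] :=
    separation_step (cK kA.1) (rK kA.1) (sK kA.1) (dK kA.1) c1 c2 d.
  by exists (P', Q').
pose A := fix A k := if k is k'.+1 then step (k', A k') else (P, Q).
have gA k : good (A k).
  by elim: k => [//|k gk] /=; have [] := stepP (k, A k) gk.
have A1S k : (A k).1 `<=` (A k.+1).1° by have [] := stepP (k, A k) (gA k).
have A2S k : (A k).2 `<=` (A k.+1).2° by have [] := stepP (k, A k) (gA k).
have mono k m : (k <= m)%N -> (A k).1 `<=` (A m).1 /\ (A k).2 `<=` (A m).2.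
  elim: m => [|m IH]; first by rewrite leqn0 => /eqP ->; split.
  rewrite leq_eqVlt => /predU1P[->|]; first by split.
  rewrite ltnS => /IH[k1 k2].
  by split=> x; [move=> /k1/A1S/interior_subset|move=> /k2/A2S/interior_subset].
exists (\bigcup_k (A k).1°), (\bigcup_k (A k).2°); split.
- by apply: bigcup_open => k _; exact: open_interior.
- by apply: bigcup_open => k _; exact: open_interior.
- by move=> x /(A1S 0); exists 1.
- by move=> x /(A2S 0); exists 1.
split.
  rewrite -subset0 => x [[k _ /interior_subset kx] [m _ /interior_subset mx]].
  have [_ _ <-] := gA (maxn k m); split.
    by have [+ _] := mono k (maxn k m) (leq_maxl _ _); exact.
  by have [_ +] := mono m (maxn k m) (leq_maxr _ _); exact.
move=> k z g Kg sg; have [_ _ _ /(_ z g Kg sg)] := stepP (k, A k) (gA k).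
by move=> [i [?|?]]; exists i; [left|right]; exists k.+1.
Qed.

End Separation.

(** * Local homeomorphisms *)

Section LocalHomeomorphisms.
Context {T U : topologicalType} (f : T -> U).

Lemma homeo_onto_imageS (A B : set T) :
  A `<=` B -> homeo_onto_image f B -> homeo_onto_image f A.
Proof.
move=> AB [g [fK cf cg]]; exists g; split.
- by move=> x /set_mem/AB Bx; apply: fK; exact: mem_set.
- by apply: (@continuous_subspaceW _ _ A B) cf.
- by apply: (@continuous_subspaceW _ _ (f @` A) (f @` B)) cg; exact: image_subset.
Qed.

Lemma homeo_onto_image_inj (A : set T) : homeo_onto_image f A -> set_inj A f.
Proof. by move=> [g [fK _ _]]; exact: can_in_inj fK. Qed.

Lemma local_homeo_open (W : set T) : local_homeo f -> open W -> open (f @` W).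
Proof.
move=> lf oW; rewrite openE => _ [x Wx <-].
have [V [oV Vx ofV [g [fK _ cg]]]] := lf x.
rewrite continuous_open_subspace // in cg.
have fVx : (f @` V) (f x) by exists x.
have nW : nbhs (f x) (g @^-1` W).
  apply: (cg (f x) (mem_set fVx)); rewrite fK ?inE //.
  exact: open_nbhs_nbhs.
rewrite /interior; apply: filterS2 nW (open_nbhs_nbhs (conj ofV fVx)) => y Wgy.
by move=> [v Vv vy]; exists v => //; rewrite -(fK v) ?inE // vy.
Qed.

End LocalHomeomorphisms.

(** * Comparison and orbits in etale groupoids *)

Section Groupoid.
Context {X G : topologicalType} (Gam : topGroupoid X G).
Local Notation r := (grng Gam).
Local Notation s := (gsrc Gam).

Lemma unit_space_hausdorff : hausdorff_space G -> hausdorff_space X.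
Proof.
rewrite !open_hausdorff => T2 x y xy.
have uxy : gunit Gam x != gunit Gam y.
  by apply: contra_neq xy => /(congr1 r); rewrite !grng_unit.
have [[A B] /= [xA yB] [oA oB AB]] := T2 _ _ uxy.
have cu := @gunit_continuous _ _ Gam.
exists (gunit Gam @^-1` A, gunit Gam @^-1` B) => /=.
  by rewrite !inE /=; rewrite !inE in xA yB.
split; [by move/continuousP : cu; exact|by move/continuousP : cu; exact|].
by rewrite -preimage_setI; move: AB => /eqP ->; rewrite preimage_set0.
Qed.

Lemma subequiv_fin (I : finType) (B : I -> set G) (A U : set X) :
  (forall i, open_bisection Gam (B i)) -> A `<=` \bigcup_i (s @` B i) ->
  trivIset setT (fun i => r @` B i) -> (forall i, r @` B i `<=` U) ->
  subequiv Gam A U.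
Proof.
move=> oB AB tB BU; exists #|I|, (fun i => B (enum_val i)); split => //.
- move=> x /AB[i _ Bx]; exists (enum_rank i) => //.
  by rewrite enum_rankK.
- by move=> i j _ _ /(tB _ _ Logic.I Logic.I) /enum_val_inj.
Qed.

Lemma subequiv_bigcup (I : finType) (A U : I -> set X) (V : set X) :
  (forall i, subequiv Gam (A i) (U i)) -> trivIset setT U ->
  (forall i, U i `<=` V) -> subequiv Gam (\bigcup_i A i) V.
Proof.
move=> AU tU UV.
have /choice[p pP] i : exists p : {m : nat & 'I_m -> set G},
    [/\ forall k, open_bisection Gam (projT2 p k),
        A i `<=` \bigcup_k (s @` projT2 p k),
        trivIset setT (fun k => r @` projT2 p k) &
        forall k, r @` projT2 p k `<=` U i].
  by have [m [B BP]] := AU i; exists (existT _ m B).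
apply: (@subequiv_fin {i : I & 'I_(projT1 (p i))}
  (fun q => projT2 (p (tag q)) (tagged q))).
- by move=> [i k]; have [] := pP i.
- move=> x [i _ Ax]; have [_ /(_ x Ax)[k _ kx] _ _] := pP i.
  by exists (Tagged (fun i => 'I_(projT1 (p i))) k).
- move=> [i k] [j l] _ _ [x [/= xi xj]].
  have ij : i = j.
    apply: tU => //; exists x; split.
      by have [_ _ _ +] := pP i; apply; exact: xi.
    by have [_ _ _ +] := pP j; apply; exact: xj.
  subst j; congr existT; have [_ _ t _] := pP i.
  by apply: t => //; exists x.
- by move=> [i k] x kx; apply: (UV i); have [_ _ _ +] := pP i; apply; exact: kx.
Qed.

Lemma subequivS (A A' U : set X) :
  A `<=` A' -> subequiv Gam A' U -> subequiv Gam A U.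
Proof. by move=> AA' [m [B [? AB ? ?]]]; exists m, B; split => // x /AA'/AB. Qed.

(** Compactness and injectivity are asked of the closure, so that translates
of closed sets by the closed bisection are closed. *)
Definition compact_bisection (b : set G) :=
  [/\ open_bisection Gam b, compact (closure b), set_inj (closure b) r
    & set_inj (closure b) s].

Definition in_orbit (z x : X) := exists2 g, s g = z & r g = x.

(** Lists without repetition are used to count, so that no finiteness of the
intersection has to be established beforehand. *)
Definition orbit_meets_le (E : set X) (k : nat) := forall z (t : seq X),
  uniq t -> (forall x, x \in t -> E x /\ in_orbit z x) -> (size t <= k)%N.

Hypothesis etG : etale Gam.

Lemma range_open (W : set G) : open W -> open (r @` W).
Proof. by case: etG => _ lr _; exact: local_homeo_open. Qed.

Lemma source_open (W : set G) : open W -> open (s @` W).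
Proof. by case: etG => _ _ ls; exact: local_homeo_open. Qed.

Lemma open_bisectionS (A B : set G) :
  open A -> A `<=` B -> open_bisection Gam B -> open_bisection Gam A.
Proof.
by move=> oA AB [_ hr hs]; split => //; exact: homeo_onto_imageS AB _.
Qed.

(** The conclusion is about all small open sets, so that the bisection can be
taken from a given basis. *)
Lemma compact_bisection_nbhs (g : G) (W : set G) :
  hausdorff_space G -> open W -> W g ->
  exists N, [/\ nbhs g N, closure N `<=` W &
    forall b, open b -> b `<=` N -> compact_bisection b].
Proof.
case: etG => lc lr ls T2 oW Wg.
have [A [oA Ag _ hA]] := lr g; have [B [oB Bg _ hB]] := ls g.
have [//|K nK [cK clK]] := lc g; rewrite withinET in nK.
have := @compact_regular _ g K T2 cK nK (A `&` B `&` W `&` K).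
case.
  by apply: filterI nK; apply: open_nbhs_nbhs; split => //;
    apply: openI => //; exact: openI.
move=> N nN NO; exists N; split => //; first by move=> x /NO[[]].
move=> b ob bN; have cbO := subset_trans (closureS bN) NO.
split.
- split => //.
    by apply: homeo_onto_imageS hA => x /subset_closure/cbO[[[]]].
  by apply: homeo_onto_imageS hB => x /subset_closure/cbO[[[]]].
- by apply: subclosed_compact cK _; [exact: closed_closure|move=> x /cbO[]].
- apply: homeo_onto_image_inj; apply: homeo_onto_imageS hA.
  by move=> x /cbO[[[]]].
- apply: homeo_onto_image_inj; apply: homeo_onto_imageS hB.
  by move=> x /cbO[[[]]].
Qed.

(** The saturation of [U] is open because the range map is open, and its
complement is a closed invariant set. *)
Lemma minimal_orbit_dense (x : X) (U : set X) :
  minimal Gam -> open U -> U !=set0 -> exists2 g, s g = x & U (r g).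
Proof.
move=> mG oU [u Uu].
pose S := r @` (s @^-1` U).
have oS : open S.
  apply: range_open; have /continuousP := @gsrc_continuous _ _ Gam; exact.
have US : U `<=` S.
  move=> y Uy; exists (gunit Gam y); rewrite ?grng_unit //=.
  by rewrite gsrc_unit.
have [||CS|CS] := mG (~` S).
- exact: open_closedC.
- apply/seteqP; split => [y nSy|_ [g nS <-] [h Uh hg]].
    by exists (gunit Gam y); rewrite ?grng_unit //= gsrc_unit.
  have e : s (ginv Gam g) = r h by rewrite gsrc_inv.
  apply: nS; exists (gmul Gam (ginv Gam g) h).
    by rewrite /= gsrc_mul.
  by rewrite grng_mul // grng_inv.
- have /contrapT[g Ug gx] : ~ (~` S) x by rewrite CS.
  by exists (ginv Gam g); rewrite ?gsrc_inv ?grng_inv.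
- by have : (~` S) u by [rewrite CS]; case; exact: US.
Qed.

(** Every unit is the source of an arrow to the isolated point, and a small
bisection around this arrow makes the unit isolated. *)
Lemma isolated_point_discrete (x : X) (A : set X) :
  minimal Gam -> open [set x] -> open A.
Proof.
move=> mG ox; rewrite openE => y Ay.
have [|g gy gx] := minimal_orbit_dense y mG ox; first by exists x.
have [_ lr _] := etG.
have [V [oV Vg _ hV]] := lr g.
have oW : open (V `&` r @^-1` [set x]).
  by apply: openI => //; have /continuousP := @grng_continuous _ _ Gam; exact.
apply: filterS (open_nbhs_nbhs (conj (source_open oW) _)).
  move=> _ [h [Vh /= hx] <-].
  have -> : h = g by apply: (homeo_onto_image_inj hV); rewrite ?inE // hx.
  by rewrite gy.
  by exists g.
Qed.

(** * Thinness of sets with bounded orbit intersections *)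

Hypotheses (T2G : hausdorff_space G) (cX : compact [set: X]).

Let T2X : hausdorff_space X := unit_space_hausdorff T2G.

Let closed_range_preimage (A : set X) : closed A -> closed (r @^-1` A).
Proof. by have /continuous_closedP := @grng_continuous _ _ Gam; exact. Qed.

Let closed_source_preimage (A : set X) : closed A -> closed (s @^-1` A).
Proof. by have /continuous_closedP := @gsrc_continuous _ _ Gam; exact. Qed.

Let compact_image (f : G -> X) (A : set G) :
  continuous f -> compact A -> closed (f @` A).
Proof. exact: compact_image_closed. Qed.

(** The induction step for one colour class.  Let [R] be the set of the points
of [E] in a piece [F j] whose translate by [b j] is also a translate by [b i] of
a point of [E] in [F i], for some [i] numbered before [j].  In a given orbit,
a point of [R] whose piece has the smallest number provides another point
of [E], in a piece with a smaller number, hence not in [R]; so [R] loses a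
point in each orbit and is comparable with [U'] by hypothesis.  Away from the
open set [O] around [R] given by this comparison, the translates of
the pieces are disjoint compact sets, which are separated inside [U]. *)
Lemma disjoint_pieces_subequiv (E U U' : set X) (J : finType) (F : J -> set X)
    (b : J -> set G) (k : nat) :
  closed E -> orbit_meets_le E k.+1 ->
  (forall R, closed R -> orbit_meets_le R k -> subequiv Gam R U') ->
  (forall j, closed (F j)) -> trivIset setT F ->
  (forall j, compact_bisection (b j)) -> (forall j, F j `<=` s @` b j) ->
  (forall j, r @` b j `<=` U) -> U `&` U' = set0 ->
  subequiv Gam (E `&` \bigcup_j F j) (U `|` U').
Proof.
move=> cE Ek IH cF tF bb Fb bU UU'.
have cr := @grng_continuous _ _ Gam; have cs := @gsrc_continuous _ _ Gam.
pose C j := closure (b j) `&` s @^-1` (E `&` F j).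
have cC j : compact (C j).
  have [_ cb _ _] := bb j; apply: compact_closedI => //.
  by apply: closed_source_preimage; exact: closedI.
pose clash (p : J * J) := s @` (C p.1 `&` r @^-1` (r @` C p.2)).
pose R := \bigcup_(p in [set p : J * J | (enum_rank p.2 < enum_rank p.1)%N])
  clash p.
have cR : closed R.
  apply: closed_bigcup_fin => p _; apply: compact_image => //.
  apply: compact_closedI => //; apply: closed_range_preimage.
  exact: compact_image.
have Rk : orbit_meets_le R k.
  move=> z [//|x0 t] ut tR.
  pose rank m := `[< exists x j, [/\ x \in x0 :: t, F j x & enum_rank j = m :> nat] >].
  have exrank : exists m, rank m.
    have [[[j i] /= _ [g [[_ [_ Fg]] _] gx]] _] := tR x0 (mem_head _ _).
    exists (enum_rank j); apply/asboolP; exists x0, j; split => //.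
      exact: mem_head.
    by rewrite -gx.
  have [m /asboolP[x [j [xt Fx jm]]] mmin] := ex_minnP exrank.
  (* [s h] is the point that [x] collides with. *)
  have [[[j' i] /= ij [g [[_ [_ Fg]] [h [_ [Eh Fh]] hg]] gx]] [a az ax]] := tR x xt.
  have jj : j' = j by apply: tF => //; exists x; split => //; rewrite -gx.
  subst j'; have nht : s h \notin x0 :: t.
    apply/negP => ht; have : rank (enum_rank i).
      by apply/asboolP; exists (s h), i.
    by move=> /mmin; rewrite -jm leqNgt ij.
  rewrite -ltnS; apply: (Ek z (s h :: x0 :: t)); first by rewrite cons_uniq nht.
  move=> y; rewrite in_cons => /predU1P[->|yt]; last first.
    have [[p _ [q [[_ [Eq _]] _] qy]] oy] := tR y yt.
    by split => //; rewrite -qy.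
  (* [s h] is in the orbit of [x], through the arrow [h^-1 g a]. *)
  split => //; exists (gmul Gam (ginv Gam h) (gmul Gam g a)).
    rewrite gsrc_mul; last by rewrite gsrc_inv hg grng_mul // gx ax.
    by rewrite gsrc_mul // gx ax.
  by rewrite grng_mul ?grng_inv // gsrc_inv hg grng_mul // gx ax.
have [m [B [oB RB tB BU']]] := IH R cR Rk.
pose O := \bigcup_i (s @` B i).
have oO : open O.
  by apply: bigcup_open => i _; apply: source_open; have [] := oB i.
pose D j := r @` (C j `&` s @^-1` (~` O)).
have cD j : closed (D j).
  apply: compact_image => //; apply: compact_closedI => //.
  by apply: closed_source_preimage; exact: open_closedC.
have tD : trivIset setT D.
  apply/trivIsetP => i j _ _; wlog : i j / (enum_rank j < enum_rank i)%N.
    move=> H ij; have [| |/val_inj/enum_rank_inj] := ltngtP (enum_rank i) (enum_rank j).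
    - by move=> lt; rewrite setIC; apply: H => //; rewrite eq_sym.
    - by move=> lt; exact: H.
    - by move=> e; rewrite e eqxx in ij.
  move=> ji _; rewrite -subset0 => x [[g [Cg nOg] gx] [h [Ch _] hx]].
  apply: nOg; have /RB : R (s g); last by [].
  exists (i, j) => //; exists g => //; split => //.
  by exists h => //; rewrite hx gx.
have [W [oW DW tW]] := compact_hausdorff_separate_fin T2X cX cD tD.
(* [true] stands for the part of [E] with disjoint translates, sent to [U], and
   [false] for the neighbourhood of [R], sent to [U']. *)
pose A (c : bool) := if c then (E `&` \bigcup_j F j) `\` O else O.
apply: (@subequivS _ (\bigcup_c A c)).
  move=> x Ex; have [Ox|nOx] := pselect (O x); first by exists false.
  by exists true.
apply: (@subequiv_bigcup _ A (fun c => if c then U else U')).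
- case=> /=; last by exists m, B; split.
  apply: (@subequiv_fin _ (fun j => b j `&` r @^-1` (W j))).
  + move=> j; have [ob _ _ _] := bb j; apply: open_bisectionS ob.
      apply: openI; first by have [[]] := bb j.
      by have /continuousP := cr; apply.
    by move=> x [].
  + move=> x [[Ex [j _ Fx]] nOx]; exists j => //.
    have [g bg gx] := Fb j x Fx; exists g => //; split => //=; apply: DW.
    exists g => //; split => /=; last by rewrite gx.
    by split; [exact: subset_closure|rewrite /= gx].
  + move=> i j _ _ [x [[g [_ /= Wg] gx] [h [_ /= Wh] hx]]].
    by apply: tW => //; exists x; split; [rewrite -gx|rewrite -hx].
  + by move=> j _ [g [bg _] <-]; apply: (bU j); exists g.
- by apply/trivIsetP => -[] [] //= _ _ _; rewrite setIC.
- by case=> x; [left|right].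
Qed.

Lemma disjoint_open_pair (U : set X) :
  (forall x : X, ~ open [set x]) -> open U -> U !=set0 ->
  exists VW : set X * set X, [/\ open VW.1 /\ open VW.2, VW.1 !=set0, VW.2 !=set0,
    VW.1 `<=` U /\ VW.2 `<=` U & VW.1 `&` VW.2 = set0].
Proof.
move=> niso oU [x Ux].
have [y [Uy yx]] : exists y, U y /\ y != x.
  apply: contrapT => nU; apply: (niso x); rewrite (_ : [set x] = U) //.
  apply/seteqP; split => [_ -> //|y Uy]; apply/eqP.
  by apply: contrapT => /negP yx; apply: nU; exists y.
have := T2X; rewrite open_hausdorff => /(_ _ _ yx)[[A B]] /=.
rewrite !inE => -[Ay Bx] [oA oB AB].
exists (U `&` A, U `&` B); split => /=.
- by split; exact: openI.
- by exists y.
- by exists x.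
- by split => z [].
- by rewrite setIACA AB setI0.
Qed.

(** Split [U] in two, keep the first half and split the second one, forever. *)
Lemma disjoint_open_sequence (U : set X) :
  (forall x : X, ~ open [set x]) -> open U -> U !=set0 ->
  exists D : nat -> set X, [/\ forall k, open (D k), forall k, D k !=set0,
    forall k, D k `<=` U & trivIset setT D].
Proof.
move=> niso oU U0.
have /choice[f fP] (V : set X) : exists VW : set X * set X, open V -> V !=set0 ->
    [/\ open VW.1 /\ open VW.2, VW.1 !=set0, VW.2 !=set0,
    VW.1 `<=` V /\ VW.2 `<=` V & VW.1 `&` VW.2 = set0].
  have [[oV V0]|nV] := pselect (open V /\ V !=set0); last first.
    by exists (V, V) => oV V0; case: nV.
  by have [VW VWP] := disjoint_open_pair niso oV V0; exists VW.
pose V k := iter k (fun V => (f V).2) U.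
have VP k : open (V k) /\ V k !=set0.
  by elim: k => [//|k [oV V0]] /=; have [[]] := fP _ oV V0.
have fV k := fP _ (VP k).1 (VP k).2.
have mono k m : (k <= m)%N -> V m `<=` V k.
  elim: m => [|m IH]; first by rewrite leqn0 => /eqP ->.
  rewrite leq_eqVlt => /predU1P[->|]; first by [].
  rewrite ltnS => /IH km.
  by apply: subset_trans km => /=; have [_ _ _ [_]] := fV m.
exists (fun k => (f (V k)).1); split.
- by move=> k; have [[]] := fV k.
- by move=> k; have [] := fV k.
- move=> k; apply: (@subset_trans _ (V k)); first by have [_ _ _ []] := fV k.
  exact: (mono 0).
apply/trivIsetP => i j _ _; wlog : i j / (i < j)%N.
  move=> H ij; have [|ji|e] := ltngtP i j; first by move=> ?; exact: H.
    by rewrite setIC; apply: H => //; rewrite eq_sym.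
  by rewrite e eqxx in ij.
move=> ij _; rewrite -subset0 => x [xi xj].
have [_ _ _ _ <-] := fV i; split => //.
apply: (mono i.+1 j ij); have [_ _ _ [+ _] _] := fV j; exact.
Qed.

(** Each colour [c] has its own open set [D c] as a target, and within it two
disjoint open sets: one for the translates of the pieces, the other for the
collisions, which are handled by induction on [k]. *)
Lemma orbit_meets_le_thin (n : nat) :
  covering_dim_le X n -> minimal Gam -> (forall x : X, ~ open [set x]) ->
  forall k E, closed E -> orbit_meets_le E k -> thin Gam E.
Proof.
move=> dim mG niso k E cE Ek; split => //.
elim: k E cE Ek => [|k IH] E cE Ek U oU U0.
  apply: (@subequiv_fin void (fun _ => set0)) => // x Ex.
  suff : (size [:: x] <= 0)%N by [].
  apply: (Ek x) => // y.
  rewrite inE => /eqP ->; split => //.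
  by exists (gunit Gam x); rewrite ?gsrc_unit ?grng_unit.
have [D [oD D0 DU tD]] := disjoint_open_sequence niso oU U0.
have /choice[V VP] (c : 'I_n.+1) :
  exists VW : set X * set X, [/\ open VW.1 /\ open VW.2, VW.1 !=set0, VW.2 !=set0,
    VW.1 `<=` D c /\ VW.2 `<=` D c & VW.1 `&` VW.2 = set0].
  exact: disjoint_open_pair.
have /choice[b bP] (p : X * 'I_n.+1) : exists b : set G,
    [/\ compact_bisection b, (s @` b) p.1 & r @` b `<=` (V p.2).1].
  have [[oV _] V0 _ _ _] := VP p.2.
  have [g gp Vg] := minimal_orbit_dense p.1 mG oV V0.
  have oW : open (r @^-1` (V p.2).1).
    by have /continuousP := @grng_continuous _ _ Gam; exact.
  have [N [nN NW Nb]] := compact_bisection_nbhs T2G oW Vg.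
  exists N°; split.
  - by apply: Nb; [exact: open_interior|exact: interior_subset].
  - by exists g.
  - move=> _ [h /interior_subset/subset_closure/NW Vh <-]; exact: Vh.
(* The colour of the piece containing [x] is not known in advance, so [Q x] has
   to be in the source of a bisection towards the target of each colour. *)
pose Q x := \bigcap_c (s @` b (x, c)).
have oQ x : open (Q x).
  apply: open_bigcap_fin => c _; apply: source_open.
  by have [[[]]] := bP (x, c).
have covQ : open_cover (range Q).
  split; first by move=> _ [x _ <-].
  apply/seteqP; split => // x _; exists (Q x); first by exists x.
  by move=> c _; have [] := bP (x, c).
have [J [F [cF tF FQ covF]]] := coloured_closed_refinement T2X cX dim covQ.
have [x0 _] := U0.
have /choice[q qP] (p : 'I_n.+1 * J) : exists x, F p.1 p.2 `<=` Q x.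
  have [->|/set0P/FQ[_ [x _ <-] Fx]] := eqVneq (F p.1 p.2) set0; first by exists x0.
  by exists x.
apply: (@subequivS _ (\bigcup_c (E `&` \bigcup_j F c j))).
  by move=> x Ex; have [c [j Fx]] := covF x; exists c => //; split => //; exists j.
apply: (@subequiv_bigcup _ _ (fun c : 'I_n.+1 => (V c).1 `|` (V c).2)).
- move=> c; have [[_ oV] _ V0 _ VV] := VP c.
  apply: (disjoint_pieces_subequiv (b := fun j => b (q (c, j), c))) Ek _ _ _ _ _ _ _ => //.
  + by move=> R cR Rk; exact: IH.
  + by move=> j; have [] := bP (q (c, j), c).
  + by move=> j x /(qP (c, j)); apply.
  + by move=> j; have [] := bP (q (c, j), c).
- move=> c d _ _ [x [xc xd]]; apply/val_inj/tD => //; exists x; split.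
    by have [_ _ _ [V1 V2] _] := VP c; case: xc => [/V1|/V2].
  by have [_ _ _ [V1 V2] _] := VP d; case: xd => [/V1|/V2].
- move=> c x xc; apply: (DU c).
  by have [_ _ _ [V1 V2] _] := VP c; case: xc => [/V1|/V2].
Qed.

(** * Neighbourhoods whose boundary is small in every orbit *)

Lemma boundary_closed (U : set X) : closed (boundary U).
Proof.
by apply: closedI; [exact: closed_closure|exact/open_closedC/open_interior].
Qed.

Lemma orbit_arrows (E : set X) (z : X) (t : seq X) :
  (forall x, x \in t -> E x /\ in_orbit z x) ->
  exists g : 'I_(size t) -> G,
    forall i, s (g i) = z /\ r (g i) = nth z t i.
Proof.
move=> tE.
have /choice[g gP] (i : 'I_(size t)) : exists a, s a = z /\ r a = nth z t i.
  by have [_ [a az ai]] := tE _ (mem_nth z (ltn_ord i)); exists a.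
by exists g.
Qed.

(** Start from [P = [set x]] and [Q] the complement of [O], and run
through all families of [n.+1] closures of basic open sets of arrows.  The
boundary of the resulting [U] avoids both open sets.  If it contained [n.+1]
distinct points of an orbit, basic compact bisections with disjoint ranges
around arrows leading to these points would be one of the families, and one of
the points would be in one of the open sets. *)
Lemma neighbourhood_small_boundary (n : nat) (x : X) (O : set X) :
  @second_countable G -> covering_dim_le X n -> open O -> O x ->
  exists U, [/\ open U, U x, U `<=` O & orbit_meets_le (boundary U) n].
Proof.
move=> [B cB [oB bB]] dim oO Ox.
have /pcard_surjP[e eB] := cB.
pose K0 k (i : 'I_n.+1) : set G :=
  if unpickle k is Some t then closure (e ((t : {ffun 'I_n.+1 -> nat}) i))
  else set0.
pose admissible k := [/\ forall i, compact (K0 k i),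
  forall i, set_inj (K0 k i) r, forall i, set_inj (K0 k i) s &
  trivIset setT (fun i => r @` K0 k i)].
(* Families that are not admissible are replaced by empty sets, for which there
   is nothing to achieve. *)
pose K k i := if `[< admissible k >] then K0 k i else set0.
have KP k : [/\ forall i, compact (K k i),
    forall i, set_inj (K k i) r, forall i, set_inj (K k i) s &
    trivIset setT (fun i => r @` K k i)].
  rewrite /K; case: asboolP => // _; split.
  - by move=> _; exact: compact0.
  - by move=> _ a b; rewrite inE.
  - by move=> _ a b; rewrite inE.
  - by move=> i j _ _ [y [[]]].
have [|||||||||U [W [oU oW xU OW [UW sepUW]]]] :=
  @separation_countable X G r s n T2X cX dim _ _ K [set x] (~` O).
- exact: grng_continuous.
- exact: gsrc_continuous.
- by move=> k; have [] := KP k.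
- by move=> k; have [] := KP k.
- by move=> k; have [] := KP k.
- by move=> k; have [] := KP k.
- exact: hausdorff_closed_set1.
- exact: open_closedC.
- by apply/disjoints_subset => _ ->; rewrite setCK.
have UO : U `<=` O.
  move=> y Uy; apply: contrapT => nOy.
  suff : (U `&` W) y by rewrite UW.
  by split => //; exact: OW.
have bUW : boundary U `<=` ~` (U `|` W).
  move=> y [cUy nUy] [Uy|Wy]; first by apply: nUy; rewrite (interior_id U).1.
  have [w Uw] := cUy W (open_nbhs_nbhs (conj oW Wy)).
  by have : set0 w by rewrite -UW.
exists U; split => //; first exact: xU.
move=> z t ut tU; rewrite leqNgt; apply/negP => nt.
have [g0 g0P] := orbit_arrows tU.
pose g (i : 'I_n.+1) := g0 (widen_ord nt i).
have gP i : s (g i) = z /\ r (g i) = nth z t i by exact: g0P.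
have rinj : trivIset setT (fun i => [set r (g i)]).
  move=> i j _ _ [y [/= -> ]]; rewrite (gP i).2 (gP j).2 => /eqP.
  rewrite nth_uniq // => [/eqP/val_inj //||]; exact: leq_ltn_trans (leq_ord _) nt.
have [V [oV gV tV]] := compact_hausdorff_separate_fin T2X cX
  (fun i => @hausdorff_closed_set1 _ T2X (r (g i))) rinj.
have /choice[m mP] i : exists m, [/\ e m (g i), compact_bisection (e m) &
    closure (e m) `<=` r @^-1` (V i)].
  have oW' : open (r @^-1` (V i)).
    by have /continuousP := @grng_continuous _ _ Gam; exact.
  have [N [nN NV Nb]] := compact_bisection_nbhs T2G oW' (gV i _ erefl).
  have [b [Bb bg] bN] := bB (g i) N nN.
  have [m _ mb] := eB b Bb; exists m; rewrite mb; split => //.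
  - by apply: Nb => //; exact: oB.
  - by apply: subset_trans NV; exact: closureS.
pose k := pickle [ffun i => m i].
have K0E i : K0 k i = closure (e (m i)) by rewrite /K0 pickleK ffunE.
have adm : admissible k.
  split.
  - by move=> i; rewrite K0E; have [_ []] := mP i.
  - by move=> i; rewrite K0E; have [_ []] := mP i.
  - by move=> i; rewrite K0E; have [_ []] := mP i.
  - move=> i j _ _ [y []]; rewrite !K0E => -[a ai ay] [b bj by_].
    have [_ _ Vi] := mP i; have [_ _ Vj] := mP j.
    apply: tV => //; exists y; split; first by rewrite -ay; exact: Vi.
    by rewrite -by_; exact: Vj.
have [|i|i UWi] := sepUW k z g.
- move=> i; rewrite /K; case: asboolP => // _; rewrite K0E.
  by apply: subset_closure; have [] := mP i.
- by have [] := gP i.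
have : boundary U (r (g i)).
  have [_ ->] := gP i.
  have ti : (i < size t)%N by exact: leq_ltn_trans (leq_ord _) nt.
  by have [] := tU _ (mem_nth z ti).
by move=> /bUW; exact.
Qed.

Lemma thin_set0 : thin Gam set0.
Proof.
split => [|U _ _]; first exact: closed0.
exact: (@subequiv_fin void (fun _ => set0)).
Qed.

End Groupoid.

Theorem theoremD (R : realType) (X G : topologicalType)
    (Gam : topGroupoid X G) :
  @second_countable G -> hausdorff_space G -> minimal Gam -> etale Gam ->
  compact [set: X] -> metrizable R X -> finite_covering_dim X ->
  thin_boundary_property Gam.
Proof.
move=> scG T2G mG etG cX _ [n dim].
exists [set U | open U /\ thin Gam (boundary U)]; last by move=> U [].
split=> [U []//|x N nN].
have [iso|niso] := pselect (exists y : X, open [set y]).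
  have [y oy] := iso.
  have oX (A : set X) : open A by exact (isolated_point_discrete etG A mG oy).
  have clX (A : set X) : closed A by rewrite -openC.
  exists [set x]; last by move=> _ ->; exact: nbhs_singleton.
  split => //; split => //.
  rewrite /boundary -((closure_id _).1 (clX _)) (interior_id _).1 //.
  by rewrite setDv; exact: thin_set0.
have niso' (y : X) : ~ open [set y] by move=> oy; apply: niso; exists y.
have [|U [oU Ux UN Un]] :=
    neighbourhood_small_boundary etG T2G cX scG dim (open_interior N) (x := x).
  by [].
exists U; last by move=> y /UN/interior_subset.
split => //; split => //.
exact: orbit_meets_le_thin dim mG niso' _ _ (boundary_closed (U := U)) Un.
Qed.
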